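(* Let $k\ge 0$, let $(\Lambda_n,p_n)_{n\ge 1}$ be a covering sequence of $k$-graphs, let $\Lambda=\lim_n(\Lambda_n,p_n)$ be the associated $(k+1)$-graph, and let $A$ be an abelian group. Regard $\Lambda_1$ as a subcategory of $\Lambda$ via the inclusion $\iota_1$. Then the restriction map $c\mapsto c|_{\Lambda_1}$ from $Z^2(\Lambda,A)$ to $Z^2(\Lambda_1,A)$ induces an isomorphism $H^2(\Lambda,A)\cong H^2(\Lambda_1,A)$.
   Context: $\mathbb N=\{0,1,2,\dots\}$. A $k$-graph is a nonempty countable small category $\Lambda$ with a functor $d:\Lambda\to\mathbb N^k$ having the factorisation property: if $d(\lambda)=m+n$ there are unique $\mu,\nu\in\Lambda$ with $d(\mu)=m$, $d(\nu)=n$, $\lambda=\mu\nu$. Write $\Lambda^n=d^{-1}(n)$; $\Lambda^0$ is the set of vertices (identity morphisms); $r(\lambda)$ and $s(\lambda)$ are the codomain and domain of $\lambda$; $\lambda\mu$ is defined iff $s(\lambda)=r(\mu)$. For $F\subseteq\Lambda$ and $v\in\Lambda^0$, $vF=\{\lambda\in F:r(\lambda)=v\}$ and $Fv=\{\lambda\in F:s(\lambda)=v\}$. The standard generators of $\mathbb N^k$ are $e_1,\dots,e_k$. A covering $p:\Gamma\to\Lambda$ of $k$-graphs is a surjective degree-preserving functor which, for each $v\in\Gamma^0$, restricts to bijections $\Gamma v\to\Lambda p(v)$ and $v\Gamma\to p(v)\Lambda$. A covering sequence $(\Lambda_n,p_n)_{n\ge1}$ consists of $k$-graphs $\Lambda_n$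 and coverings $p_n:\Lambda_{n+1}\to\Lambda_n$. The associated $(k+1)$-graph $\Lambda=\lim_n(\Lambda_n,p_n)$ is the unique $(k+1)$-graph with injective functors $\iota_n:\Lambda_n\to\Lambda$ and a bijection $\epsilon:\bigsqcup_{n\ge2}\Lambda_n^0\to\Lambda^{e_{k+1}}$ such that (identifying $\mathbb N^{k+1}$ with $\mathbb N^k\oplus\mathbb N$): (1) $d(\iota_n(\lambda))=(d(\lambda),0)$; (2) $\iota_m(\Lambda_m)\cap\iota_n(\Lambda_n)=\emptyset$ for $m\ne n$; (3) $\bigsqcup_n\iota_n(\Lambda_n)=\{\lambda\in\Lambda:d(\lambda)_{k+1}=0\}$; (4) $s(\epsilon(v))=\iota_{n+1}(v)$ and $r(\epsilon(v))=\iota_n(p_n(v))$ for $v\in\Lambda_{n+1}^0$; (5) $\epsilon(r(\lambda))\iota_{n+1}(\lambda)=\iota_n(p_n(\lambda))\epsilon(s(\lambda))$ for $\lambda\in\Lambda_{n+1}$. Categorical cohomology: for $r\ge1$, $\Lambda^{*r}$ is the set of composable $r$-tuples, and $\Lambda^{*0}=\Lambda^0$. $C^r(\Lambda,A)$ is the group of functions $f:\Lambda^{*r}\to A$ with $f(\lambda_1,\dots,\lambda_r)=0$ whenever some $\lambda_i\in\Lambda^0$ (all functions if $r=0$). $\delta^0(f)(\lambda)=f(s(\lambda))-f(r(\lambda))$ and, for $r\ge1$, $\delta^r(f)(\lambda_0,\dots,\lambda_r)=f(\lambda_1,\dots,\lambda_r)+\sum_{i=1}^r(-1)^if(\lambda_0,\dots,\lambda_{i-1}\lambda_i,\dots,\lambda_r)+(-1)^{r+1}f(\lambda_0,\dots,\lambda_{r-1})$.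 $Z^r(\Lambda,A)=\ker\delta^r$, $B^r(\Lambda,A)=\operatorname{im}\delta^{r-1}$, $H^r(\Lambda,A)=Z^r(\Lambda,A)/B^r(\Lambda,A)$. *)

(* Defs.v *)
From HB Require Import structures.
From mathcomp Require Import all_boot all_order all_algebra.
From mathcomp Require Import boolp classical_sets functions.

Set Implicit Arguments.
Unset Strict Implicit.
Unset Printing Implicit Defensive.

Import GRing.Theory.
Local Open Scope quotient_scope.
Local Open Scope ring_scope.
Local Open Scope classical_set_scope.

(* Countable small categories.  Composition is written as in the literature on
   k-graphs: [comp l m] is l m and makes sense only when [src l = tgt m].  As a
   Rocq function it is total, but its values on other pairs are irrelevant:
   nothing below depends on them. *)
Record category := Category {
  obj : countType;
  mor :> countType;
  src : mor -> obj;
  tgt : mor -> obj;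
  idm : obj -> mor;
  comp : mor -> mor -> mor;
  src_idm : forall v, src (idm v) = v;
  tgt_idm : forall v, tgt (idm v) = v;
  src_comp : forall l m, src l = tgt m -> src (comp l m) = src m;
  tgt_comp : forall l m, src l = tgt m -> tgt (comp l m) = tgt l;
  comp_idl : forall l, comp (idm (tgt l)) l = l;
  comp_idr : forall l, comp l (idm (src l)) = l;
  comp_assoc : forall l m n, src l = tgt m -> src m = tgt n ->
    comp l (comp m n) = comp (comp l m) n
}.

Record functor (C D : category) := Functor {
  fobj : obj C -> obj D;
  fmor :> C -> D;
  src_fmor : forall l, src (fmor l) = fobj (src l);
  tgt_fmor : forall l, tgt (fmor l) = fobj (tgt l);
  fmor_idm : forall v, fmor (idm v) = idm (fobj v);
  fmor_comp : forall l m, src l = tgt m ->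
    fmor (comp l m) = comp (fmor l) (fmor m)
}.

(* N^k is [nat ^ k], i.e. {ffun 'I_k -> nat}, with pointwise addition.  The
   vertex set of a k-graph, d^-1(0), is identified with [obj] via [idm]; by
   the factorisation property the morphisms of degree 0 are the identities. *)
Record kgraph (k : nat) := KGraph {
  kcat :> category;
  deg : kcat -> (nat ^ k)%type;
  kgraph_inhabited : inhabited kcat;
  deg_idm : forall v, deg (idm v) = 0;
  deg_comp : forall l m : kcat, src l = tgt m ->
    deg (comp l m) = deg l + deg m;
  factorisation : forall (l : kcat) (m n : (nat ^ k)%type), deg l = m + n ->
    exists! mu_nu : kcat * kcat,
      [/\ deg mu_nu.1 = m, deg mu_nu.2 = n, src mu_nu.1 = tgt mu_nu.2
        & l = comp mu_nu.1 mu_nu.2]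
}.

Record is_covering k (G L : kgraph k) (p : functor G L) : Prop := IsCovering {
  covering_deg : forall l : G, deg (p l) = deg l;
  covering_surj : set_surj [set: G] [set: L] p;
  covering_src : forall v : obj G,
    set_bij [set l : G | src l = v] [set l : L | src l = fobj p v] p;
  covering_tgt : forall v : obj G,
    set_bij [set l : G | tgt l = v] [set l : L | tgt l = fobj p v] p
}.

(* Indices are shifted by one: [cs_graph Lam n] is Lambda_{n+1} and
   [cs_map Lam n] is p_{n+1} : Lambda_{n+2} -> Lambda_{n+1}. *)
Record covering_sequence (k : nat) := CoveringSequence {
  cs_graph :> nat -> kgraph k;
  cs_map : forall n, functor (cs_graph n.+1) (cs_graph n);
  cs_map_covering : forall n, is_covering (cs_map n)
}.

(* The element (m, j) of N^(k+1) = N^k (+) N. *)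
Definition deg_pair k (m : (nat ^ k)%type) (j : nat) : (nat ^ k.+1)%type :=
  [ffun i : 'I_k.+1 => if unlift ord_max i is Some i' then m i' else j].

(* [L], with the inclusions [iota] and the bijection [eps], is the
   (k+1)-graph lim (Lambda_n, p_n).  With the shifted indices, the [n]th
   component of [eps] is defined on the vertices of [Lam n.+1]. *)
Record is_limit k (Lam : covering_sequence k) (L : kgraph k.+1)
    (iota : forall n, functor (Lam n) L)
    (eps : forall n, obj (Lam n.+1) -> L) : Prop := IsLimit {
  limit_iota_inj : forall n, injective (iota n);
  limit_eps_bij :
    set_bij [set: {n : nat & obj (Lam n.+1)}]
            [set l : L | deg l = deg_pair 0 1]
            (fun x => eps (projT1 x) (projT2 x));
  limit_deg : forall n (l : Lam n), deg (iota n l) = deg_pair (deg l) 0;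
  limit_disjoint : forall m n, m <> n ->
    range (iota m) `&` range (iota n) = set0;
  limit_cover : \bigcup_n range (iota n) = [set l : L | deg l ord_max = 0%N];
  limit_src_eps : forall n (v : obj (Lam n.+1)),
    src (eps n v) = fobj (iota n.+1) v;
  limit_tgt_eps : forall n (v : obj (Lam n.+1)),
    tgt (eps n v) = fobj (iota n) (fobj (cs_map Lam n) v);
  limit_comm : forall n (l : Lam n.+1),
    comp (eps n (tgt l)) (iota n.+1 l) =
    comp (iota n (cs_map Lam n l)) (eps n (src l))
}.

Section Nerve.
Variable C : category.

Definition composable : rel C := fun l m => src l == tgt m.

(* The set of composable r-tuples, with the convention for r = 0. *)
Definition nerve (r : nat) : Type :=
  if r is q.+1 then {t : q.+1.-tuple C | sorted composable t} else obj C.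

(* Replaces the entries x_i, x_(i+1) of [s] (counted from 0) by x_i x_(i+1). *)
Fixpoint contract (i : nat) (s : seq C) : seq C :=
  match i, s with
  | 0%N, x :: y :: s' => comp x y :: s'
  | j.+1, x :: s' => x :: contract j s'
  | _, _ => s
  end.

Lemma size_contract i s : (i.+1 < size s)%N -> size (contract i s) = (size s).-1.
Proof.
elim: i s => [|i IHi] [|x [|y s]] //= lt_i_s.
by rewrite IHi.
Qed.

Lemma contract_tupleP q (i : 'I_q.+1) (t : q.+2.-tuple C) :
  size (contract i t) == q.+1.
Proof. by rewrite size_contract size_tuple //= ltnS. Qed.
Canonical contract_tuple q i t := Tuple (@contract_tupleP q i t).

Lemma path_contract i x s :
  path composable x s -> path composable x (contract i s).
Proof.
elim: i x s => [|i IHi] x [|y s] //=.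
- case: s => [|z s] //= /and3P[/eqP xy /eqP yz].
  rewrite /composable tgt_comp // xy eqxx /=.
  by case: s => [|w s] //=; rewrite src_comp.
- by case/andP=> -> /IHi.
Qed.

Lemma sorted_contract i s :
  sorted composable s -> sorted composable (contract i s).
Proof.
case: i s => [|i] [|x s] //=; last exact: path_contract.
case: s => [|y [|z s]] //= /and3P[/eqP xy /eqP yz ->].
by rewrite /composable src_comp // yz eqxx.
Qed.

Lemma sorted_behead (s : seq C) :
  sorted composable s -> sorted composable (behead s).
Proof. by case: s => //= x s /path_sorted. Qed.

Lemma sorted_belast x (s : seq C) :
  path composable x s -> sorted composable (belast x s).
Proof.
elim: s x => [|y s IHs] x //= /andP[xy /IHs].
by case: s {IHs} => //= z s; rewrite xy.
Qed.

Lemma sorted_belast_tuple q (t : q.+1.-tuple C) :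
  sorted composable t -> sorted composable (belast (thead t) (behead t)).
Proof. by case/tupleP: t => x t; rewrite theadE; apply: sorted_belast. Qed.

Definition nerve_behead q (t : nerve q.+2) : nerve q.+1 :=
  exist (fun u : q.+1.-tuple C => sorted composable u)
    [tuple of behead (val t)] (sorted_behead (valP t)).

Definition nerve_contract q (i : 'I_q.+1) (t : nerve q.+2) : nerve q.+1 :=
  exist (fun u : q.+1.-tuple C => sorted composable u)
    [tuple of contract i (val t)] (sorted_contract i (valP t)).

Definition nerve_belast q (t : nerve q.+2) : nerve q.+1 :=
  exist (fun u : q.+1.-tuple C => sorted composable u)
    [tuple of belast (thead (val t)) (behead (val t))]
    (sorted_belast_tuple (valP t)).

Definition degenerate r : nerve r -> Prop :=
  if r is q.+1 then fun t => exists v, idm v \in val t else fun=> False.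

End Nerve.

Section Cohomology.
Variables (C : category) (A : zmodType).

(* Membership in C^r(C, A). *)
Definition is_cochain r (f : nerve C r -> A) : Prop :=
  forall t, degenerate t -> f t = 0.

Definition coboundary r : (nerve C r -> A) -> nerve C r.+1 -> A :=
  match r with
  | 0%N => fun f t => f (src (thead (val t))) - f (tgt (thead (val t)))
  | q.+1 => fun f t =>
      f (nerve_behead t)
      + \sum_(i < q.+1) f (nerve_contract i t) *~ ((-1) ^+ i.+1)
      + f (nerve_belast t) *~ ((-1) ^+ q.+2)
  end.

Lemma coboundaryB r : {morph @coboundary r : f g / f - g}.
Proof.
case: r => [|q] f g; apply/funext => t /=; rewrite !fctE.
  by rewrite !opprD !opprK addrACA.
rewrite mulrzBl (eq_bigr _ (fun i _ => mulrzBl _ _ _)) sumrB.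
by rewrite !opprD [RHS]addrACA [in RHS](addrACA (f _)).
Qed.

Definition cocycle r : {pred nerve C r -> A} :=
  [pred f | `[< is_cochain f /\ coboundary f = 0 >]].

Lemma coboundary0 r : @coboundary r 0 = 0.
Proof. by rewrite -[X in coboundary X](subrr 0) coboundaryB subrr. Qed.

Lemma cocycle_zmod_closed r : zmod_closed (@cocycle r).
Proof.
split=> [|f g /asboolP[f0 df] /asboolP[g0 dg]]; apply/asboolP.
  by split; [|exact: coboundary0].
split=> [t dt|]; last by rewrite coboundaryB df dg subrr.
by rewrite !fctE f0 // g0 // subrr.
Qed.
HB.instance Definition _ r :=
  GRing.isZmodClosed.Build (nerve C r -> A) (@cocycle r)
    (@cocycle_zmod_closed r).

(* The group Z^r(C, A). *)
Record Zgroup (r : nat) := ZGroup {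
  cochain_of :> nerve C r -> A;
  cochain_ofP : cochain_of \in @cocycle r
}.
HB.instance Definition _ r := [isSub for @cochain_of r].
HB.instance Definition _ r := [Choice of Zgroup r by <:].
HB.instance Definition _ r := [SubChoice_isSubZmodule of Zgroup r by <:].

(* Elements of B^r(C, A), where B^0 = 0. *)
Definition is_coboundary r : (nerve C r -> A) -> Prop :=
  match r with
  | 0%N => fun f => f = 0
  | q.+1 => fun f => exists2 g : nerve C q -> A, is_cochain g & coboundary g = f
  end.

(* B^r(C, A) as a subset of Z^r(C, A).  As coboundary \o coboundary = 0 and
   coboundaries of cochains are cochains, requiring that an element lie in
   Z^r is no restriction. *)
Definition Bpred r : {pred Zgroup r} := [pred z | `[< is_coboundary (val z) >]].

Lemma Bpred_zmod_closed r : zmod_closed (@Bpred r).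
Proof.
split=> [|y z /asboolP By /asboolP Bz]; apply/asboolP; rewrite ?raddf0 ?raddfB.
  by case: r => [|q] //=; exists 0; rewrite ?coboundary0.
case: r y z By Bz => [|q] y z /=; first by move=> -> ->; rewrite subrr.
move=> [f f0 <-] [g g0 <-]; exists (f - g); last exact: coboundaryB.
by move=> t dt; rewrite !fctE f0 // g0 // subrr.
Qed.
HB.instance Definition _ r :=
  GRing.isZmodClosed.Build (Zgroup r) (@Bpred r) (@Bpred_zmod_closed r).

(* The group H^r(C, A) = Z^r(C, A) / B^r(C, A). *)
Definition Hgroup (r : nat) : zmodType := Quotient.quot (@Bpred r).

Definition cohomology_class r (z : Zgroup r) : Hgroup r :=
  \pi_(Quotient.quot (@Bpred r)) z.

End Cohomology.

Arguments Zgroup C A r : clear implicits.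
Arguments Hgroup C A r : clear implicits.

Section Restriction.
Variables (C D : category) (F : functor C D) (A : zmodType).

Lemma sorted_fmor (s : seq C) :
  sorted (@composable C) s -> sorted (@composable D) (map F s).
Proof.
rewrite sorted_map; apply: sub_sorted => l m /= /eqP lm.
by rewrite /composable src_fmor tgt_fmor lm.
Qed.

Definition nerve_map r : nerve C r -> nerve D r :=
  match r with
  | 0%N => fobj F
  | q.+1 => fun t =>
      exist (fun u : q.+1.-tuple D => sorted (@composable D) u)
        [tuple of map F (val t)] (sorted_fmor (valP t))
  end.

Lemma degenerate_map r (t : nerve C r) :
  degenerate t -> degenerate (nerve_map t).
Proof.
case: r t => [|q] t //= [v vt]; exists (fobj F v).
by rewrite -fmor_idm map_f.
Qed.

Lemma map_contract i (s : seq C) : sorted (@composable C) s ->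
  map F (contract i s) = contract i (map F s).
Proof.
elim: i s => [|i IHi] [|x s] //=; last by move=> /path_sorted /IHi ->.
by case: s => [|y s] //= /andP[/eqP xy _]; rewrite fmor_comp.
Qed.

Lemma coboundary_map r (f : nerve D r -> A) :
  coboundary (f \o @nerve_map r) = coboundary f \o @nerve_map r.+1.
Proof.
case: r f => [|q] f; apply/funext => t /=.
  case: t => t st /=; case/tupleP: t st => x t st.
  by rewrite /thead !tnth_map src_fmor tgt_fmor.
congr (_ + _ + _ *~ _).
- by congr f; apply/val_inj/val_inj; rewrite /= behead_map.
- apply: eq_bigr => i _; congr (f _ *~ _).
  by apply/val_inj/val_inj; rewrite /= map_contract //; exact: (valP t).
- congr f; apply/val_inj/val_inj => /=.
  by rewrite /thead tnth_map behead_map belast_map.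
Qed.

Lemma cocycle_map r (z : Zgroup D A r) :
  z \o @nerve_map r \in @cocycle C A r.
Proof.
have /asboolP[z0 dz] := cochain_ofP z; apply/asboolP; split.
  by move=> t /degenerate_map /z0.
by rewrite coboundary_map dz.
Qed.

(* Restriction of cocycles to [C], seen inside [D] via [F]. *)
Definition restrict r (z : Zgroup D A r) : Zgroup C A r :=
  ZGroup (cocycle_map z).

End Restriction.

(* Main.v *)
From HB Require Import structures.
From mathcomp Require Import all_boot all_order all_algebra.
From mathcomp Require Import boolp classical_sets functions.
Require Import Defs.

(** Lambda_1 is a reflective subcategory of Lambda, and the inclusion of a
    reflective subcategory is a homotopy equivalence of nerves.

    Concretely, a vertex v of Lambda_n is the source of a path of n - 1 edges
    [eps], running through v, p v, p (p v), ... down to a vertex of Lambda_1;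
    call it eta_v.  Let l be a morphism from x to y in Lambda.  The degree of
    eta_y l is a sum (d, 0) + (0, j), and factorising accordingly gives
    eta_y l = a b.  Here a has range in Lambda_1 and is horizontal, so it lies
    in Lambda_1; and b is vertical, so it is a path of [eps]'s from x down to
    Lambda_1, that is, b = eta_x.  Hence there is exactly one P l in Lambda_1
    with iota_1(P l) eta_x = eta_y l ([to_bottom_universal]).  Uniqueness makes
    P a functor Lambda -> Lambda_1, the equation says that eta is a natural
    transformation from the identity to iota_1 P ([reflector]), and
    P iota_1 = id because eta is trivial on Lambda_1.  (Below, the levels of the
    sequence are counted from 0, so that Lambda_1 is [Lam 0].)

    Functors related by a natural transformation pull a 2-cocycle back to
    cohomologous 2-cocycles ([restrict_natural]), so the maps on H^2 induced by
    iota_1 and by P are inverse to each other ([restrict_reflective_iso]). *)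

Set Implicit Arguments.
Unset Strict Implicit.
Unset Printing Implicit Defensive.

Import GRing.Theory.
Local Open Scope ring_scope.
Local Open Scope quotient_scope.
Local Open Scope classical_set_scope.

(** * Low-degree cochains as functions of morphisms *)

Section Classes.
Variables (C : category) (A : zmodType).

Lemma cohomology_class_eqP r (y z : Zgroup C A r) :
  cohomology_class y = cohomology_class z <->
  is_coboundary (val y - val z).
Proof.
rewrite -raddfB; split=> [/eqP|Byz].
  by rewrite -Quotient.idealrBE => /asboolP.
by apply/eqP; rewrite -Quotient.idealrBE; apply/asboolP.
Qed.

(** A 2-cochain as a function of two morphisms, so that equations between
    morphisms can be rewritten in its arguments without carrying along proofs
    of composability; pairs that are not composable get the junk value 0. *)
Definition cochain2 (f : nerve C 2 -> A) (l m : C) : A :=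
  if insub [tuple l; m] is Some t then f t else 0.

Lemma cochain2E (f : nerve C 2 -> A) (t : nerve C 2) l m :
  val t = [:: l; m] :> seq C -> f t = cochain2 f l m.
Proof.
move=> t_lm; rewrite /cochain2; have -> : [tuple l; m] = val t.
  by apply: val_inj; exact: esym.
by rewrite valK.
Qed.

Lemma cochain2_idm (f : nerve C 2 -> A) l m v :
  is_cochain f -> idm v \in [:: l; m] -> cochain2 f l m = 0.
Proof.
move=> f0 v_lm; rewrite /cochain2; case: insubP => // t _ t_lm.
by apply: f0; exists v; rewrite t_lm.
Qed.

Lemma cocycle2E (z : Zgroup C A 2) l m n : src l = tgt m -> src m = tgt n ->
  cochain2 z m n + cochain2 z l (comp m n) =
  cochain2 z (comp l m) n + cochain2 z l m.
Proof.
move=> lm mn; have /asboolP[_ dz] := cochain_ofP z.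
have lmnP : sorted (@composable C) [tuple l; m; n].
  by rewrite /= /composable lm mn !eqxx.
have := congr1 (fun f => f (exist _ [tuple l; m; n] lmnP)) dz.
rewrite /= !big_ord_recl big_ord0.
rewrite (@cochain2E _ _ m n) // (@cochain2E _ _ (comp l m) n) //.
rewrite (@cochain2E _ _ l (comp m n)) // (@cochain2E _ _ l m) //=.
rewrite !mulrN1z mulr1z addr0 addrCA => /eqP.
by rewrite subr_eq0 addrC subr_eq => /eqP ->; rewrite addrC.
Qed.

Lemma coboundary1E (b : C -> A) (t : nerve C 2) l m :
  val t = [:: l; m] :> seq C ->
  coboundary (fun u : nerve C 1 => b (thead (val u))) t =
  b m - b (comp l m) + b l.
Proof.
case: t => -[[|x [|y [|]]] //= s2] sP [<- <-].
rewrite /= big_ord_recl big_ord0 addr0 mulrN1z mulr1z.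
by rewrite /thead /= !(tnth_nth x).
Qed.

Lemma nerve2P (t : nerve C 2) :
  {lm : C * C | val t = [:: lm.1; lm.2] :> seq C & src lm.1 = tgt lm.2}.
Proof.
case: t => -[[|x [|y [|]]] //= s2] sP; exists (x, y) => //=.
by move: sP => /= /andP[/eqP].
Qed.

End Classes.

(** * Natural transformations and cohomology *)

(** The three hypotheses are the cocycle identity at the three 3-simplices of
    the prism over a composable pair; the conclusion compares the values at the
    two ends of the prism. *)
Lemma homotopy_identity (A : zmodType) (a b c d e f g h i j : A) :
    a + b = c + d -> e + f = c + g -> h + f = i + j ->
  a - j = (e - h) - (b - i) + (d - g).
Proof.
move=> /(canRL (addrK _)) -> /esym/(canRL (addrK _)) ->.
rewrite [i + j]addrC => /esym/(canRL (addrK _)) ->.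
rewrite !opprD !opprK !addrA.
by rewrite [LHS](ACl (1*6*5*8*4*3*(2*7)))%AC /= subrr addr0.
Qed.

Section Homotopy.
Variables (C D : category) (F G : functor C D) (theta : obj C -> D).
Hypotheses (src_theta : forall v, src (theta v) = fobj F v)
  (tgt_theta : forall v, tgt (theta v) = fobj G v)
  (natural_theta : forall l,
     comp (theta (tgt l)) (F l) = comp (G l) (theta (src l))).

(** The prism operator: the natural transformation splits the naturality square
    of l into the two triangles (theta, F l) and (G l, theta), and the
    difference of the values of [z] on them is a 1-cochain whose coboundary is
    the difference of the two pullbacks of [z]. *)
Lemma restrict_natural (A : zmodType) (z : Zgroup D A 2) :
  cohomology_class (restrict F z) = cohomology_class (restrict G z).
Proof.
have /asboolP[z0 _] := cochain_ofP z.
pose b l := cochain2 z (theta (tgt l)) (F l) - cochain2 z (G l) (theta (src l)).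
apply/cohomology_class_eqP; exists (fun t : nerve C 1 => b (thead (val t))).
  (* The 1-cochain vanishes on identities because [z] is normalised. *)
  move=> t [v]; case: t => -[[|x []] //= s1] sP; rewrite inE => /eqP vx.
  rewrite /b /thead (tnth_nth x) /= -vx !fmor_idm src_idm tgt_idm.
  rewrite (cochain2_idm (v := fobj F v) z0) ?inE ?eqxx ?orbT //.
  by rewrite (cochain2_idm (v := fobj G v) z0) ?inE ?eqxx ?subrr.
apply/funext => t; have [[l m] t_lm lm] := nerve2P t.
rewrite /= in t_lm lm.
rewrite (coboundary1E b t_lm) !fctE /=.
rewrite (@cochain2E _ _ _ _ (F l) (F m)) /= ?t_lm //.
rewrite (@cochain2E _ _ _ _ (G l) (G m)) /= ?t_lm //.
rewrite /b src_comp // tgt_comp // !fmor_comp //.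
have FF : src (F l) = tgt (F m) by rewrite src_fmor tgt_fmor lm.
have GG : src (G l) = tgt (G m) by rewrite src_fmor tgt_fmor lm.
have thF x : src (theta (tgt x)) = tgt (F x) by rewrite src_theta tgt_fmor.
have Gth x : src (G x) = tgt (theta (src x)) by rewrite tgt_theta src_fmor.
(* The simplices of the prism are (theta, F l, F m), (G l, theta, F m) and
   (G l, G m, theta); naturality identifies the faces that they share. *)
apply/esym; apply: homotopy_identity (cocycle2E z (thF l) FF) _ _.
  rewrite natural_theta lm; apply: cocycle2E => //.
  by rewrite -lm.
rewrite natural_theta; exact: cocycle2E.
Qed.

End Homotopy.

(** * Functoriality of cohomology *)

Section InducedMap.
Variables (C D : category) (F : functor C D) (A : zmodType).

Lemma restrict_class r (y z : Zgroup D A r) :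
  cohomology_class y = cohomology_class z ->
  cohomology_class (restrict F y) = cohomology_class (restrict F z).
Proof.
move/cohomology_class_eqP => Byz; apply/cohomology_class_eqP.
have -> : val (restrict F y) - val (restrict F z)
    = (val y - val z) \o @nerve_map _ _ F r by [].
move: Byz; case: r y z => [|q] y z /=; first by move=> ->.
move=> [g g0 <-]; exists (g \o @nerve_map _ _ F q).
  by move=> t /(degenerate_map F) /g0.
exact: coboundary_map.
Qed.

Lemma restrictB r (y z : Zgroup D A r) :
  restrict F (y - z) = restrict F y - restrict F z.
Proof. exact: val_inj. Qed.

Lemma cohomology_class_surj r (x : Hgroup D A r) :
  exists z, x = cohomology_class z.
Proof. by exists (repr x); rewrite /cohomology_class reprK. Qed.

Lemma restriction_additive r :
  exists phi : {additive Hgroup D A r -> Hgroup C A r},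
  forall z, phi (cohomology_class z) = cohomology_class (restrict F z).
Proof.
pose phi (x : Hgroup D A r) : Hgroup C A r :=
  cohomology_class (restrict F (repr x)).
have phiE z : phi (cohomology_class z) = cohomology_class (restrict F z).
  by apply: restrict_class; rewrite /cohomology_class reprK.
have phiB : zmod_morphism phi.
  move=> x y; have [u ->] := cohomology_class_surj x.
  have [v ->] := cohomology_class_surj y.
  by rewrite -[_ - _]raddfB !phiE restrictB -raddfB.
pose phiM := GRing.isZmodMorphism.Build _ _ phi phiB.
pose phiA : {additive _ -> _} := HB.pack phi phiM.
by exists phiA.
Qed.

End InducedMap.

Definition idF (C : category) : functor C C :=
  @Functor C C id id (fun=> erefl) (fun=> erefl) (fun=> erefl)
    (fun _ _ _ => erefl).

Lemma restrict_idF C (A : zmodType) r (z : Zgroup C A r) :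
  restrict (idF C) z = z.
Proof.
apply/val_inj/funext; case: r z => [|q] z t //=.
by congr (z _); apply/val_inj/val_inj; rewrite /= map_id.
Qed.

Section Composite.
Variables (B C D : category) (F : functor C D) (E : functor B C).

Lemma compF_comp l m : src l = tgt m ->
  F (E (comp l m)) = comp (F (E l)) (F (E m)).
Proof.
by move=> lm; rewrite !fmor_comp // src_fmor tgt_fmor lm.
Qed.

Definition compF : functor B D :=
  @Functor B D (fobj F \o fobj E) (F \o E)
    (fun l => etrans (src_fmor F _) (congr1 _ (src_fmor E l)))
    (fun l => etrans (tgt_fmor F _) (congr1 _ (tgt_fmor E l)))
    (fun v => etrans (congr1 _ (fmor_idm E v)) (fmor_idm F _))
    compF_comp.

Lemma restrict_compF (A : zmodType) r (z : Zgroup D A r) :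
  restrict compF z = restrict E (restrict F z).
Proof.
apply/val_inj/funext; case: r z => [|q] z t //=.
by congr (z _); apply/val_inj/val_inj; rewrite /= map_comp.
Qed.

End Composite.

Lemma eq_restrict C D (F G : functor C D) (A : zmodType) r
    (z : Zgroup D A r.+1) :
  F =1 G -> restrict F z = restrict G z.
Proof.
move=> FG; apply/val_inj/funext => t /=.
by congr (z _); apply/val_inj/val_inj; rewrite /= (eq_map FG).
Qed.

(** * Reflective subcategories *)

Section Reflection.
Variables (C D : category) (I : functor C D).
Variables (ob : obj D -> obj C) (eta : obj D -> D).
Hypotheses (src_eta : forall x, src (eta x) = x)
  (tgt_eta : forall x, tgt (eta x) = fobj I (ob x))
  (eta_universal : forall l : D, exists! m : C,
    [/\ src m = ob (src l), tgt m = ob (tgt l)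
      & comp (I m) (eta (src l)) = comp (eta (tgt l)) l]).

(** Sending l to the arrow that universality provides is functorial because
    identities and composites satisfy the equations that characterise the
    arrows chosen for them. *)
Lemma reflector : exists2 P : functor D C, fobj P =1 ob &
  forall l, comp (I (P l)) (eta (src l)) = comp (eta (tgt l)) l.
Proof.
have [P PP] := choice eta_universal.
have srcP l : src (P l) = ob (src l) by have [[]] := PP l.
have tgtP l : tgt (P l) = ob (tgt l) by have [[]] := PP l.
have natP l : comp (I (P l)) (eta (src l)) = comp (eta (tgt l)) l.
  by have [[]] := PP l.
have uniqP l m : src m = ob (src l) -> tgt m = ob (tgt l) ->
    comp (I m) (eta (src l)) = comp (eta (tgt l)) l -> P l = m.
  by move=> ms mt mc; have [_] := PP l; apply.
have P1 v : P (idm v) = idm (ob v).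
  apply: uniqP; rewrite ?src_idm ?tgt_idm // fmor_idm -tgt_eta comp_idl.
  by rewrite -[X in comp _ (idm X)]src_eta comp_idr.
have PM l m : src l = tgt m -> P (comp l m) = comp (P l) (P m).
  move=> lm; have Plm : src (P l) = tgt (P m) by rewrite srcP lm tgtP.
  apply: uniqP; rewrite ?src_comp ?tgt_comp // fmor_comp //.
  rewrite -comp_assoc ?src_fmor ?tgt_fmor ?Plm ?tgt_eta ?srcP //.
  rewrite natP comp_assoc ?src_eta ?src_fmor ?srcP ?tgt_eta ?lm //.
  by rewrite -lm natP comp_assoc ?src_eta.
by exists (Functor srcP tgtP P1 PM).
Qed.

Hypotheses (obI : forall v, ob (fobj I v) = v)
  (etaI : forall v, eta (fobj I v) = idm (fobj I v)).

(** As [eta] is trivial on the image of I, the reflector is a strict left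
    inverse of I; it is a right inverse up to the natural transformation [eta],
    which cohomology does not see. *)
Lemma restrict_reflective_iso (A : zmodType) :
  exists phi : {additive Hgroup D A 2 -> Hgroup C A 2},
    bijective phi /\
    forall z, phi (cohomology_class z) = cohomology_class (restrict I z).
Proof.
have [P obP natP] := reflector.
have PI m : P (I m) = m.
  have [m' [_ uniq_m']] := eta_universal (I m).
  rewrite -(uniq_m' (P (I m))) ?(uniq_m' m) //; split=> //.
  - by rewrite src_fmor obI.
  - by rewrite tgt_fmor obI.
  - by rewrite src_fmor tgt_fmor !etaI -src_fmor comp_idr -tgt_fmor comp_idl.
  - by rewrite src_fmor obP.
  - by rewrite tgt_fmor obP.
have [phi phiE] := restriction_additive I A 2.
have [psi psiE] := restriction_additive P A 2.
exists phi; split=> //; exists psi => x; have [z ->] := cohomology_class_surj x.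
  rewrite phiE psiE -restrict_compF -[in RHS](restrict_idF z).
  apply/esym; apply: (@restrict_natural _ _ (idF D) (compF I P) eta).
  - exact: src_eta.
  - by move=> v; rewrite tgt_eta /= obP.
  - by move=> l; rewrite /= natP.
rewrite psiE phiE -restrict_compF -[in RHS](restrict_idF z).
by congr cohomology_class; apply: eq_restrict.
Qed.

End Reflection.

(** * Degrees and factorisations *)

Lemma deg_pairD k (m n : (nat ^ k)%type) i j :
  deg_pair m i + deg_pair n j = deg_pair (m + n) (i + j)%N.
Proof.
by apply/ffunP => x; rewrite !ffunE; case: unliftP => //= y; rewrite ffunE.
Qed.

Lemma deg_pair_max k (m : (nat ^ k)%type) j : deg_pair m j ord_max = j.
Proof. by rewrite ffunE unlift_none. Qed.

Lemma deg_pair_surj k (d : (nat ^ k.+1)%type) :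
  exists m, d = deg_pair m (d ord_max).
Proof.
exists [ffun i => d (lift ord_max i)]; apply/ffunP => x; rewrite ffunE.
by case: unliftP => [y ->|->] //; rewrite ffunE.
Qed.

Lemma deg_pair0 k : deg_pair (0 : (nat ^ k)%type) 0 = 0.
Proof.
by apply/ffunP => x; rewrite !ffunE; case: unliftP => //= y; rewrite ffunE.
Qed.

Section KGraph.
Variables (k : nat) (L : kgraph k).

(** Degrees lie in a cancellative monoid, so [a] and [b] have the same degree;
    then (a, c) and (b, c) are both the factorisation of one morphism in the
    same degrees. *)
Lemma comp_rcancel (a b c : L) : src a = tgt c -> src b = tgt c ->
  comp a c = comp b c -> a = b.
Proof.
move=> ac bc eq_c.
have dab : deg a = deg b.
  have := congr1 (@deg _ L) eq_c; rewrite !deg_comp // => /ffunP dE.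
  by apply/ffunP => i; apply: (@addIn (deg c i)); have := dE i; rewrite !ffunE.
have [x [_ ux]] := factorisation (deg_comp ac).
have -> : a = x.1 by rewrite (ux (a, c)).
by rewrite (ux (b, c)) //= -dab.
Qed.

(** Both (l, idm) and (idm, l) are factorisations of l in degrees (0, 0). *)
Lemma deg0_idm (l : L) : deg l = 0 -> l = idm (tgt l).
Proof.
move=> dl; have [|x [_ ux]] := @factorisation _ L l 0 0; first by rewrite addr0.
have {1}-> : l = x.1.
  by rewrite (ux (l, idm (src l))) //= deg_idm tgt_idm comp_idr.
by rewrite (ux (idm (tgt l), l)) //= deg_idm src_idm comp_idl.
Qed.

End KGraph.

(** * The first graph of a covering sequence is reflective in the limit *)

Section Limit.
Variables (k : nat) (Lam : covering_sequence k) (L : kgraph k.+1)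
  (iota : forall n, functor (Lam n) L) (eps : forall n, obj (Lam n.+1) -> L).
Hypothesis hL : is_limit iota eps.

Definition vertex (x : {n : nat & obj (Lam n)}) : obj L :=
  fobj (iota (projT1 x)) (projT2 x).

Lemma iota_range_disjoint m n (l : Lam m) (l' : Lam n) :
  iota m l = iota n l' -> m = n.
Proof.
move=> eq_l; apply/eqP/negP => /negP/eqP/(limit_disjoint hL) disj.
have : (range (iota m) `&` range (iota n)) (iota m l).
  by split; [exists l | exists l'].
by rewrite disj.
Qed.

Lemma iota_obj_disjoint m n (u : obj (Lam m)) (v : obj (Lam n)) :
  fobj (iota m) u = fobj (iota n) v -> m = n.
Proof.
by move/(congr1 (@idm L)); rewrite -!fmor_idm => /iota_range_disjoint.
Qed.

Lemma iota_obj_inj n : injective (fobj (iota n)).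
Proof.
move=> u v /(congr1 (@idm L)); rewrite -!fmor_idm => /(limit_iota_inj hL).
by move/(congr1 (@src _)); rewrite !src_idm.
Qed.

Lemma vertex_inj : injective vertex.
Proof.
move=> [m u] [n v]; rewrite /vertex /= => uv.
by have mn := iota_obj_disjoint uv; subst n; rewrite (iota_obj_inj uv).
Qed.

Lemma horizontal_mor (l : L) : deg l ord_max = 0%N ->
  exists n, exists m : Lam n, l = iota n m.
Proof.
move=> dl; have : [set l : L | deg l ord_max = 0%N] l by [].
by rewrite -(limit_cover hL) => -[n _ [m _ <-]]; exists n, m.
Qed.

Lemma vertex_surj (x : obj L) : exists y, vertex y = x.
Proof.
have [|n [m im]] := @horizontal_mor (idm x); first by rewrite deg_idm ffunE.
by exists (existT _ n (src m)); rewrite /vertex /= -src_fmor -im src_idm.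
Qed.

Fixpoint eps_path n : obj (Lam n) -> L :=
  if n is n'.+1 return obj (Lam n) -> L then
    fun v => comp (eps_path (fobj (cs_map Lam n') v)) (eps v)
  else fun v => idm (fobj (iota 0) v).

Fixpoint bottom n : obj (Lam n) -> obj (Lam 0) :=
  if n is n'.+1 return obj (Lam n) -> obj (Lam 0) then
    fun v => bottom (fobj (cs_map Lam n') v)
  else id.

Lemma eps_pathP n (v : obj (Lam n)) :
  [/\ src (eps_path v) = fobj (iota n) v,
      tgt (eps_path v) = fobj (iota 0) (bottom v)
    & deg (eps_path v) = deg_pair 0 n].
Proof.
elim: n v => [|n IHn] v /=.
  by rewrite src_idm tgt_idm deg_idm deg_pair0.
have [s_p t_p d_p] := IHn (fobj (cs_map Lam n) v).
have pe : src (eps_path (fobj (cs_map Lam n) v)) = tgt (eps v).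
  by rewrite s_p (limit_tgt_eps hL).
rewrite src_comp // tgt_comp // deg_comp // (limit_src_eps hL) d_p.
have /= -> : deg (eps v) = deg_pair 0 1.
  by have [/(_ (existT _ n v) I)] := limit_eps_bij hL.
by rewrite deg_pairD addr0 addn1.
Qed.

(** A vertical morphism factors into edges, each of which is some [eps w].  As
    the images of the graphs are disjoint, going up from the range each edge has
    to come from the next level. *)
Lemma vertical_mor j (b : L) (u : obj (Lam 0)) :
  deg b = deg_pair 0 j -> tgt b = fobj (iota 0) u ->
  exists v : obj (Lam j), b = eps_path v.
Proof.
elim: j b => [|j IHj] b db tb.
  by exists u => /=; rewrite -tb; apply: deg0_idm; rewrite db deg_pair0.
have [|[b' e] [[/= db' de b'e bE] _]] :=
    @factorisation _ L b (deg_pair 0 j) (deg_pair 0 1).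
  by rewrite deg_pairD addr0 addn1.
have [|v b'v] := IHj _ db'.
  by rewrite -tb bE tgt_comp.
have [_ _ eps_surj] := limit_eps_bij hL.
have [[n w] _ /= ew] := eps_surj e de.
have [s_p _ _] := eps_pathP v.
have vw : fobj (iota j) v = fobj (iota n) (fobj (cs_map Lam n) w).
  by rewrite -s_p -b'v b'e -ew (limit_tgt_eps hL).
have jn := iota_obj_disjoint vw; subst n; exists w.
by rewrite /= bE -ew b'v (iota_obj_inj vw).
Qed.

Definition to_bottom (x : {n : nat & obj (Lam n)}) : L := eps_path (projT2 x).

(** The arrow m is the horizontal factor of [comp (to_bottom y) l].  The other,
    vertical factor has the same source as [to_bottom x] and its range in the
    first graph, so [vertical_mor] identifies it with [to_bottom x].  Uniqueness
    is right cancellation. *)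
Lemma to_bottom_universal (x y : {n : nat & obj (Lam n)}) (l : L) :
    src l = vertex x -> tgt l = vertex y ->
  exists! m : Lam 0, [/\ src m = bottom (projT2 x), tgt m = bottom (projT2 y)
    & comp (iota 0 m) (to_bottom x) = comp (to_bottom y) l].
Proof.
move=> lx ly; have [sx tx _] := eps_pathP (projT2 x).
have [sy ty _] := eps_pathP (projT2 y).
set f := comp (to_bottom y) l.
have sf : src f = vertex x by rewrite src_comp ?lx // ly; exact: sy.
have tf : tgt f = fobj (iota 0) (bottom (projT2 y)).
  by rewrite tgt_comp ?ty // ly; exact: sy.
have [d df] := deg_pair_surj (deg f); set j := deg f _ in df.
have [|[a b] [[/= da db ab fE] _]] :=
    @factorisation _ L f (deg_pair d 0) (deg_pair 0 j).
  by rewrite deg_pairD addr0 add0n.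
have [|n [m aE]] := @horizontal_mor a; first by rewrite da deg_pair_max.
have ta : tgt a = fobj (iota 0) (bottom (projT2 y)) by rewrite -tf fE tgt_comp.
have n0 : n = 0%N.
  apply: (@iota_obj_disjoint _ _ (tgt m) (bottom (projT2 y))).
  by rewrite -tgt_fmor -aE.
subst n.
have [|v bE] := @vertical_mor j b (src m) db; first by rewrite -ab aE src_fmor.
have xE : x = existT _ j v.
  apply: vertex_inj; rewrite -sf fE src_comp // bE.
  by have [-> _ _] := eps_pathP v.
have bx : b = to_bottom x by rewrite bE xE.
have mx : src m = bottom (projT2 x).
  apply: (@iota_obj_inj 0); rewrite -src_fmor -aE ab bx; exact: tx.
exists m; split.
  split=> //; first by apply: (@iota_obj_inj 0); rewrite -tgt_fmor -aE.
  by rewrite -aE -bx -fE.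
move=> m' [sm' _ m'f]; apply: (limit_iota_inj hL).
apply: (@comp_rcancel _ L _ _ (to_bottom x)).
- by rewrite src_fmor mx; exact: esym tx.
- by rewrite src_fmor sm'; exact: esym tx.
- by rewrite m'f fE -bx -aE.
Qed.

End Limit.

Theorem theorem3p6 (k : nat) (Lam : covering_sequence k) (L : kgraph k.+1)
    (iota : forall n, functor (Lam n) L)
    (eps : forall n, obj (Lam n.+1) -> L)
    (hL : is_limit iota eps) (A : zmodType) :
  exists phi : {additive Hgroup L A 2 -> Hgroup (Lam 0%N) A 2},
    bijective phi /\
    (forall c : Zgroup L A 2,
       phi (cohomology_class c) = cohomology_class (restrict (iota 0%N) c)).
Proof.
have [pos posK] := choice (vertex_surj hL).
have vertexK v : pos (fobj (iota 0%N) v) = existT _ 0%N v.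
  by apply: (vertex_inj hL); rewrite posK.
apply: (@restrict_reflective_iso _ _ (iota 0%N)
  (fun x => bottom (projT2 (pos x))) (fun x => to_bottom iota eps (pos x))).
- move=> x; rewrite -[RHS]posK.
  by have [] := eps_pathP hL (projT2 (pos x)).
- by move=> x; have [] := eps_pathP hL (projT2 (pos x)).
- by move=> l; apply: to_bottom_universal; rewrite ?posK.
- by move=> v; rewrite vertexK.
- by move=> v; rewrite vertexK.
Qed.
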